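(* Let $\zeta\in\{0,1\}$, let $n$ be an integer, let $\lambda_n=(2n+\zeta)\pi$, and assume $\lambda_n\neq0$. For integers $m\ge0$ put $$I^\zeta_m(n)=\int_{-1}^{1}T_m(x)\,e^{i\lambda_n\frac{x+1}{2}}\,dx .$$ Then $I^0_0(n)=0$ if $\zeta=0$ and $I^1_0(n)=\frac{4i}{\lambda_n}$ if $\zeta=1$, and for every $m\ge1$, $$I^\zeta_m(n)=2i\,\frac{(-1)^m-(-1)^\zeta}{\lambda_n}+\frac{2im}{\lambda_n}\begin{cases}2\displaystyle\sum_{\substack{1\le j\le m-1\\ j\text{ odd}}}I^\zeta_j(n), & m\text{ even},\\[2ex] 2\displaystyle\sum_{\substack{0\le j\le m-1\\ j\text{ even}}}I^\zeta_j(n)-I^\zeta_0(n), & m\text{ odd}.\end{cases}$$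
   Context: $T_m$ denotes the $m$-th Chebyshev polynomial of the first kind. The case $\zeta=0$ corresponds to bosonic and $\zeta=1$ to fermionic Matsubara frequencies. *)

(* Defs.v *)
From Stdlib Require Import Reals ZArith.
From Coquelicot Require Import Coquelicot.

Open Scope R_scope.

Fixpoint chebyshevT (m : nat) (x : R) : R :=
  match m with
  | O => 1
  | S p => match p with
           | O => x
           | S q => 2 * x * chebyshevT p x - chebyshevT q x
           end
  end.

Definition Cexp (z : C) : C :=
  (RtoC (exp (Re z)) * (RtoC (cos (Im z)) + Ci * RtoC (sin (Im z))))%C.

(* Matsubara frequency: bosonic for zeta = 0, fermionic for zeta = 1. *)
Definition lambda (zeta : nat) (n : Z) : R := (2 * IZR n + INR zeta) * PI.

Definition chebI (zeta m : nat) (n : Z) : C :=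
  RInt (V := C_R_CompleteNormedModule)
    (fun x : R =>
       (RtoC (chebyshevT m x) *
        Cexp (Ci * RtoC (lambda zeta n) * RtoC ((x + 1) / 2)))%C)
    (-1) 1.

Definition Csum_cond (P : nat -> bool) (f : nat -> C) (a b : nat) : C :=
  sum_n_m (G := C_AbelianMonoid) (fun j => if P j then f j else RtoC 0) a b.

(* Main.v *)
Require Import Defs.
From Stdlib Require Import Reals ZArith Lia Lra.
From Coquelicot Require Import Coquelicot.

(** Integrating by parts against [exp(i l (x+1)/2)] trades [T_m] for its
    derivative [m U_(m-1)], with boundary term fixed by [T_m(1) = 1],
    [T_m(-1) = (-1)^m] and [exp(i lambda_n) = (-1)^zeta].  The recurrence
    [U_(m+2) = U_m + 2 T_(m+2)] then unfolds the integral of [U_(m-1)] into the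
    sum of the [I_j] with [j] of the parity of [m-1], in which [T_0 = U_0]
    counts only once. *)

Open Scope R_scope.

Lemma nat_pair_ind (P : nat -> Prop) :
  P 0%nat -> P 1%nat -> (forall m, P m -> P (S m) -> P (S (S m))) ->
  forall m, P m.
Proof.
  intros H0 H1 HS m.
  enough (P m /\ P (S m)) by tauto.
  induction m as [|m [IH IH']]; auto.
Qed.

(** * Chebyshev polynomials *)

Fixpoint chebyshevU (m : nat) (x : R) : R :=
  match m with
  | O => 1
  | S p => match p with
           | O => 2 * x
           | S q => 2 * x * chebyshevU p x - chebyshevU q x
           end
  end.

Lemma chebyshevT_SS (m : nat) (x : R) :
  chebyshevT (S (S m)) x = 2 * x * chebyshevT (S m) x - chebyshevT m x.
Proof. reflexivity. Qed.

Lemma chebyshevU_SS (m : nat) (x : R) :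
  chebyshevU (S (S m)) x = 2 * x * chebyshevU (S m) x - chebyshevU m x.
Proof. reflexivity. Qed.

Lemma chebyshevT_1 (m : nat) : chebyshevT m 1 = 1.
Proof.
  induction m as [| |m IH IH'] using nat_pair_ind; [reflexivity..|].
  rewrite chebyshevT_SS, IH, IH'; ring.
Qed.

Lemma chebyshevT_m1 (m : nat) : chebyshevT m (-1) = (-1) ^ m.
Proof.
  induction m as [| |m IH IH'] using nat_pair_ind; [simpl; ring..|].
  rewrite chebyshevT_SS, IH, IH'; simpl; ring.
Qed.

(** Both sides obey the same three-term recurrence. Eliminating [chebyshevT] this way turns the
    later identities into [ring] goals in [chebyshevU] alone. *)
Lemma chebyshevT_S (m : nat) (x : R) :
  chebyshevT (S m) x = chebyshevU (S m) x - x * chebyshevU m x.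
Proof.
  induction m as [| |m IH IH'] using nat_pair_ind; [simpl; ring..|].
  rewrite chebyshevT_SS, IH, IH', !chebyshevU_SS; ring.
Qed.

Lemma chebyshevU_SS_T (m : nat) (x : R) :
  chebyshevU (S (S m)) x = chebyshevU m x + 2 * chebyshevT (S (S m)) x.
Proof. rewrite chebyshevT_S, !chebyshevU_SS; ring. Qed.

Lemma is_derive_recurrence (f g : R -> R) (x df dg : R) :
  is_derive f x df -> is_derive g x dg ->
  is_derive (fun y => 2 * y * f y - g y) x (2 * f x + 2 * x * df - dg).
Proof.
  intros Hf Hg; auto_derive; [split; [|split]; auto; eexists; eassumption|].
  rewrite (is_derive_unique (fun y : R => f y) _ _ Hf).
  rewrite (is_derive_unique (fun y : R => g y) _ _ Hg); ring.
Qed.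

Lemma ex_derive_chebyshevU (m : nat) (x : R) : ex_derive (chebyshevU m) x.
Proof.
  induction m as [| |m [d Hd] [d' Hd']] using nat_pair_ind.
  - apply ex_derive_const.
  - unfold chebyshevU; auto_derive; auto.
  - eexists; apply is_derive_recurrence; eassumption.
Qed.

Lemma is_derive_chebyshevT_S (m : nat) (x : R) :
  is_derive (chebyshevT (S m)) x (INR (S m) * chebyshevU m x).
Proof.
  induction m as [| |m IH IH'] using nat_pair_ind.
  - unfold chebyshevT; auto_derive; [auto | simpl; ring].
  - unfold chebyshevT; auto_derive; [auto | simpl; ring].
  (* The differentiated recurrence. With T_(m+2) = U_(m+2) - x U_(m+1) it becomes 2 U_(m+2) + (m+1)
     (2x U_(m+1) - U_m), and the last bracket is U_(m+2) again. *)
  - replace (INR (S (S (S m))) * chebyshevU (S (S m)) x)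
      with (2 * chebyshevT (S (S m)) x
            + 2 * x * (INR (S (S m)) * chebyshevU (S m) x)
            - INR (S m) * chebyshevU m x)
      by (rewrite chebyshevT_S, !chebyshevU_SS, !S_INR; ring).
    exact (is_derive_recurrence _ _ _ _ _ IH' IH).
Qed.

(* At [m = 0] the truncated index is harmless, since the factor [INR m] is 0. *)
Lemma is_derive_chebyshevT (m : nat) (x : R) :
  is_derive (chebyshevT m) x (INR m * chebyshevU (m - 1) x).
Proof.
  destruct m as [|m].
  - rewrite Rmult_0_l; exact (is_derive_const (V := R_NormedModule) 1 x).
  - rewrite Nat.sub_1_r; apply is_derive_chebyshevT_S.
Qed.

(** * Integrals against a complex exponential *)

Definition wave (l x : R) : C := Cexp (Ci * RtoC l * RtoC ((x + 1) / 2)).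

Lemma wave_pair (l x : R) :
  wave l x = (cos (l * ((x + 1) / 2)), sin (l * ((x + 1) / 2))).
Proof.
  unfold wave, Cexp.
  replace (Re (Ci * RtoC l * RtoC ((x + 1) / 2))) with 0 by (simpl; ring).
  replace (Im (Ci * RtoC l * RtoC ((x + 1) / 2))) with (l * ((x + 1) / 2))
    by (simpl; ring).
  rewrite exp_0; apply injective_projections; simpl; ring.
Qed.

(** Writing the pair as p times 1 plus q times i reduces the claim to real functions scaling
    constant vectors. *)
Lemma is_derive_Cpair (p q : R -> R) (x dp dq : R) :
  is_derive p x dp -> is_derive q x dq ->
  is_derive (V := C_R_NormedModule) (fun y => (p y, q y) : C) x (dp, dq).
Proof.
  intros Hp Hq.
  apply (is_derive_ext (V := C_R_NormedModule)
    (fun y => plus (scal (p y) (RtoC 1 : C_R_NormedModule))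
                   (scal (q y) (Ci : C_R_NormedModule)))).
  { intros y; apply injective_projections; cbn; unfold mult; simpl; ring. }
  replace ((dp, dq) : C_R_NormedModule)
    with (plus (scal dp (RtoC 1 : C_R_NormedModule))
               (scal dq (Ci : C_R_NormedModule)))
    by (apply injective_projections; cbn; unfold mult; simpl; ring).
  apply (is_derive_plus (V := C_R_NormedModule));
    apply (is_derive_scal_l (V := C_R_NormedModule)); assumption.
Qed.

Lemma is_derive_mult_wave (l : R) (f : R -> R) (x df : R) :
  is_derive f x df ->
  is_derive (V := C_R_NormedModule) (fun y => RtoC (f y) * wave l y)%C x
    (RtoC df * wave l x + Ci * RtoC (l / 2) * (RtoC (f x) * wave l x))%C.
Proof.
  intros Hf.
  apply (is_derive_ext (V := C_R_NormedModule)
    (fun y => (f y * cos (l * ((y + 1) / 2)), f y * sin (l * ((y + 1) / 2))) : C)).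
  { intros y; rewrite wave_pair; apply injective_projections; simpl; ring. }
  rewrite wave_pair.
  match goal with |- is_derive _ _ ?d => rewrite (surjective_pairing d) end.
  apply is_derive_Cpair; auto_derive;
    try (eexists; eassumption);
    rewrite (is_derive_unique (fun y : R => f y) _ _ Hf); simpl; unfold Rdiv; ring.
Qed.

Lemma continuous_mult_wave (l : R) (f : R -> R) (x : R) :
  ex_derive f x ->
  continuous (U := C_R_NormedModule) (fun y => RtoC (f y) * wave l y)%C x.
Proof.
  intros [df Hf].
  apply (ex_derive_continuous (V := C_R_NormedModule)).
  eexists; apply is_derive_mult_wave, Hf.
Qed.

(** A relation rather than a value of [RInt], so that integrability travels with the value through
    the linearity lemmas. *)
Definition is_wave_int (l : R) (f : R -> R) (J : C) : Prop :=
  is_RInt (V := C_R_NormedModule) (fun x => RtoC (f x) * wave l x)%C (-1) 1 J.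

Lemma is_wave_int_plus (l : R) (f g : R -> R) (J K : C) :
  is_wave_int l f J -> is_wave_int l g K ->
  is_wave_int l (fun x => f x + g x) (J + K)%C.
Proof.
  intros HJ HK.
  apply (is_RInt_ext (V := C_R_NormedModule)
    (fun x => plus (RtoC (f x) * wave l x : C_R_NormedModule)%C
                   (RtoC (g x) * wave l x : C_R_NormedModule)%C)).
  { intros x _; rewrite RtoC_plus; symmetry; apply Cmult_plus_distr_r. }
  apply (is_RInt_plus (V := C_R_NormedModule)); assumption.
Qed.

Lemma is_wave_int_scal (l a : R) (f : R -> R) (J : C) :
  is_wave_int l f J -> is_wave_int l (fun x => a * f x) (RtoC a * J)%C.
Proof.
  intros HJ.
  apply (is_RInt_ext (V := C_R_NormedModule)
    (fun x => scal a (RtoC (f x) * wave l x : C_R_NormedModule)%C)).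
  { intros x _; rewrite scal_R_Cmult, RtoC_mult; apply Cmult_assoc. }
  rewrite <- scal_R_Cmult.
  apply (is_RInt_scal (V := C_R_NormedModule)); exact HJ.
Qed.

(** Here C is a real normed module, so i is not a scalar; multiplication by it is the rotation (u,
    v) to (-v, u), integrated by components. *)
Lemma is_RInt_Ci_mult (f : R -> C) (a b : R) (J : C) :
  is_RInt (V := C_R_NormedModule) f a b J ->
  is_RInt (V := C_R_NormedModule) (fun x => Ci * f x)%C a b (Ci * J)%C.
Proof.
  intros HJ.
  apply (is_RInt_ext (V := C_R_NormedModule)
    (fun x => (- Im (f x), Re (f x)) : C)).
  { intros x _; apply injective_projections; simpl; unfold Re, Im; ring. }
  replace (Ci * J)%C with ((- Im J, Re J) : C)
    by (apply injective_projections; simpl; unfold Re, Im; ring).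
  apply (is_RInt_fct_extend_pair (U := R_NormedModule) (V := R_NormedModule)).
  - apply (is_RInt_opp (V := R_NormedModule)).
    exact (is_RInt_fct_extend_snd (U := R_NormedModule) (V := R_NormedModule)
             f a b J HJ).
  - exact (is_RInt_fct_extend_fst (U := R_NormedModule) (V := R_NormedModule)
             f a b J HJ).
Qed.

(** Both sides evaluate the integral of the derivative of [f] times the wave: the left by the
    product rule and linearity, the right by the fundamental theorem of calculus. Differentiability
    of [df] supplies the continuity that theorem requires. *)
Lemma wave_int_by_parts (l : R) (f df : R -> R) (J K : C) :
  (forall x, is_derive f x (df x)) -> (forall x, ex_derive df x) ->
  is_wave_int l f J -> is_wave_int l df K ->
  (K + Ci * RtoC (l / 2) * J
   = RtoC (f 1%R) * wave l 1 - RtoC (f (-1)%R) * wave l (-1))%C.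
Proof.
  intros Hf Hdf HJ HK.
  set (F := fun x => (RtoC (f x) * wave l x)%C).
  set (dF := fun x => (RtoC (df x) * wave l x + Ci * RtoC (l / 2) * F x)%C).
  assert (HF : is_RInt (V := C_R_NormedModule) dF (-1) 1 (F 1 - F (-1))%C).
  { apply (is_RInt_derive (V := C_R_CompleteNormedModule) F dF).
    - intros x _; apply is_derive_mult_wave, Hf.
    - intros x _; unfold dF.
      apply (continuous_plus (V := C_R_NormedModule)).
      + apply continuous_mult_wave, Hdf.
      + apply (continuous_scal_r (K := C_AbsRing) (V := C_NormedModule)).
        apply continuous_mult_wave; eexists; apply Hf. }
  transitivity (RInt (V := C_R_CompleteNormedModule) dF (-1) 1); [symmetry|];
    apply (is_RInt_unique (V := C_R_CompleteNormedModule)); [|exact HF].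
  apply (is_RInt_ext (V := C_R_NormedModule)
    (fun x => plus (RtoC (df x) * wave l x : C_R_NormedModule)%C
                   (scal (l / 2) (Ci * F x : C_R_NormedModule)%C))).
  { intros x _; rewrite scal_R_Cmult.
    transitivity (RtoC (df x) * wave l x + RtoC (l / 2) * (Ci * F x))%C;
      [reflexivity | unfold dF; apply (f_equal2 Cplus); [reflexivity | ring]]. }
  rewrite (Cmult_comm Ci), <- Cmult_assoc, <- scal_R_Cmult.
  apply (is_RInt_plus (V := C_R_NormedModule)); [exact HK|].
  apply (is_RInt_scal (V := C_R_NormedModule)).
  apply is_RInt_Ci_mult, HJ.
Qed.

(** * Wave integrals of T_m and U_m at the Matsubara frequencies *)

Lemma chebI_correct (zeta m : nat) (n : Z) :
  is_wave_int (lambda zeta n) (chebyshevT m) (chebI zeta m n).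
Proof.
  apply (RInt_correct (V := C_R_CompleteNormedModule)).
  apply (ex_RInt_continuous (V := C_R_CompleteNormedModule)).
  intros x _; apply continuous_mult_wave.
  eexists; apply is_derive_chebyshevT.
Qed.

Lemma wave_lambda (zeta : nat) (n : Z) :
  zeta = 0%nat \/ zeta = 1%nat -> wave (lambda zeta n) 1 = (RtoC (-1) ^ zeta)%C.
Proof.
  intros Hz; rewrite wave_pair, <- RtoC_pow.
  replace (lambda zeta n * ((1 + 1) / 2)) with (2 * (IZR n * PI) + INR zeta * PI)
    by (unfold lambda; field).
  (* The double-angle formulas express the cosine and sine of 2 n pi through sin (n pi) = 0, which
     covers every integer n without induction. *)
  rewrite cos_plus, sin_plus, cos_2a_sin, sin_2a.
  rewrite (sin_eq_0_1 (IZR n * PI)) by (exists n; reflexivity).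
  apply injective_projections; destruct Hz as [-> | ->]; simpl;
    rewrite ?Rmult_0_l, ?Rmult_1_l, ?cos_0, ?sin_0, ?cos_PI, ?sin_PI; ring.
Qed.

Lemma wave_m1 (l : R) : wave l (-1) = 1%C.
Proof.
  rewrite wave_pair; replace (l * ((-1 + 1) / 2)) with 0 by field.
  now rewrite cos_0, sin_0.
Qed.

Open Scope C_scope.

(** Closed form of the integral of U_m against the wave. Every term of the parity of m counts twice
    except j = 0, hence the subtraction in the even case. The theorem's bracket at m is this value
    at m - 1, with the parities exchanged. *)
Definition chebU_int (zeta m : nat) (n : Z) : C :=
  if Nat.even m then
    RtoC 2 * Csum_cond Nat.even (fun j => chebI zeta j n) 0 m - chebI zeta 0 n
  else RtoC 2 * Csum_cond Nat.odd (fun j => chebI zeta j n) 1 m.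

(** Of the two new indices, the one of the wrong parity is filtered out. *)
Lemma Csum_cond_SS (P : nat -> bool) (f : nat -> C) (a m : nat) :
  (a <= S m)%nat -> P (S m) = false -> P (S (S m)) = true ->
  Csum_cond P f a (S (S m)) = Csum_cond P f a m + f (S (S m)).
Proof.
  intros Ha H1 H2; unfold Csum_cond.
  rewrite !sum_n_Sm, H1, H2 by lia.
  unfold plus; simpl; ring.
Qed.

Lemma chebU_int_correct (zeta m : nat) (n : Z) :
  is_wave_int (lambda zeta n) (chebyshevU m) (chebU_int zeta m n).
Proof.
  induction m as [| |m IH _] using nat_pair_ind.
  - replace (chebU_int zeta 0 n) with (chebI zeta 0 n).
    { apply chebI_correct. }
    unfold chebU_int, Csum_cond; simpl; rewrite sum_n_n; simpl; ring.
  - replace (chebU_int zeta 1 n) with (RtoC 2 * chebI zeta 1 n).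
    { apply is_wave_int_scal, chebI_correct. }
    unfold chebU_int, Csum_cond; simpl; rewrite sum_n_n; simpl; ring.
  - replace (chebU_int zeta (S (S m)) n)
      with (chebU_int zeta m n + RtoC 2 * chebI zeta (S (S m)) n).
    + apply (is_RInt_ext (V := C_R_NormedModule)
        (fun x => RtoC (chebyshevU m x + 2 * chebyshevT (S (S m)) x)
                  * wave (lambda zeta n) x)).
      { intros x _; now rewrite chebyshevU_SS_T. }
      apply is_wave_int_plus; [exact IH|].
      apply is_wave_int_scal, chebI_correct.
    + unfold chebU_int; rewrite Nat.even_succ_succ.
      destruct (Nat.even m) eqn:Hm.
      * rewrite Csum_cond_SS; [ring | lia | |].
        -- now rewrite Nat.even_succ, <- Nat.negb_even, Hm.
        -- now rewrite Nat.even_succ_succ.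
      * rewrite Csum_cond_SS; [ring | lia | |].
        -- now rewrite Nat.odd_succ.
        -- now rewrite Nat.odd_succ, Nat.even_succ, <- Nat.negb_even, Hm.
Qed.

(** The integration by parts solved for I_m. It includes m = 0, where the truncated [m - 1] is
    multiplied by [INR 0], so the initial values come from the same formula. *)
Lemma chebI_by_parts (zeta : nat) (hzeta : zeta = 0%nat \/ zeta = 1%nat)
  (n : Z) (hlambda : lambda zeta n <> 0%R) (m : nat) :
  chebI zeta m n =
    RtoC 2 * Ci * ((RtoC (-1) ^ m - RtoC (-1) ^ zeta) / RtoC (lambda zeta n))
    + RtoC 2 * Ci * RtoC (INR m) / RtoC (lambda zeta n)
      * chebU_int zeta (m - 1) n.
Proof.
  assert (E := wave_int_by_parts (lambda zeta n) (chebyshevT m) _ _ _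
    (is_derive_chebyshevT m)
    (fun x => ex_derive_scal _ _ _ (ex_derive_chebyshevU (m - 1) x))
    (chebI_correct zeta m n)
    (is_wave_int_scal _ (INR m) _ _ (chebU_int_correct zeta (m - 1) n))).
  rewrite chebyshevT_1, chebyshevT_m1, wave_lambda, wave_m1, RtoC_pow in E by easy.
  assert (Hl : RtoC (lambda zeta n) <> 0) by (intros Hz; apply hlambda, RtoC_inj, Hz).
  assert (Hi : Ci * Ci = RtoC (-1)) by (apply injective_projections; simpl; ring).
  unfold Rdiv in E; rewrite RtoC_mult, RtoC_inv in E by lra.
  set (L := RtoC (lambda zeta n)) in *.
  set (K := chebU_int zeta (m - 1) n) in *.
  set (J := chebI zeta m n) in *.
  set (p := RtoC (-1) ^ m) in *; set (q := RtoC (-1) ^ zeta) in *.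
  (* Since i * i = -1, the factor -2i/L inverts the coefficient i L/2 that multiplies J in [E]. *)
  replace J with (- (RtoC 2 * Ci / L) * (Ci * (L * / RtoC 2) * J)).
  - replace (Ci * (L * / RtoC 2) * J)
      with (RtoC 1 * q - p * RtoC 1 - RtoC (INR m) * K) by (rewrite <- E; ring).
    field; exact Hl.
  - transitivity (- (Ci * Ci) * J); [field; exact Hl | rewrite Hi; ring].
Qed.

Theorem mainTheorem2 (zeta : nat) (hzeta : zeta = 0%nat \/ zeta = 1%nat)
  (n : Z) (hlambda : lambda zeta n <> 0%R) :
  (zeta = 0%nat -> chebI zeta 0 n = RtoC 0) /\
  (zeta = 1%nat -> chebI zeta 0 n = RtoC 4 * Ci / RtoC (lambda zeta n)) /\
  (forall m : nat, (1 <= m)%nat ->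
     chebI zeta m n =
       RtoC 2 * Ci *
         ((RtoC (-1) ^ m - RtoC (-1) ^ zeta) / RtoC (lambda zeta n)) +
       RtoC 2 * Ci * RtoC (INR m) / RtoC (lambda zeta n) *
         (if Nat.even m then
            RtoC 2 * Csum_cond Nat.odd (fun j => chebI zeta j n) 1 (m - 1)
          else
            RtoC 2 * Csum_cond Nat.even (fun j => chebI zeta j n) 0 (m - 1)
            - chebI zeta 0 n)).
Proof.
  pose proof (chebI_by_parts zeta hzeta n hlambda) as H.
  assert (Hl : RtoC (lambda zeta n) <> 0) by (intros Hz; apply hlambda, RtoC_inj, Hz).
  split; [|split].
  (* At m = 0 only the boundary term 2i (1 - (-1)^zeta) / lambda survives: 0 in the bosonic case, 4i
     / lambda in the fermionic one. *)
  - intros ->; rewrite H; simpl; field; exact Hl.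
  - intros ->; rewrite H; simpl; field; exact Hl.
  - intros [|m] Hm; [lia|].
    rewrite H at 1; unfold chebU_int.
    (* Passing from the index S m to m flips the parity, which matches the two branches with those
       of [chebU_int]. *)
    rewrite Nat.even_succ, <- Nat.negb_even, Nat.sub_1_r; simpl Nat.pred.
    now destruct (Nat.even m).
Qed.
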